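(* Let $G$ be a finite group acting on a regular Hom-pre-Lie algebra $(A,\cdot,\alpha)$ over a field $\mathbb{K}$ of characteristic zero. If $\widetilde H^2_G(A,A)=0$, then every equivariant formal deformation of $A$ is equivalent to the trivial deformation, that is, $A$ is equivariantly rigid.
   Context: A Hom-pre-Lie algebra $(A,\cdot,\alpha)$ is a $\mathbb{K}$-vector space $A$ with a bilinear product $\cdot$ and a linear map $\alpha:A\to A$ such that for all $a,b,c\in A$: $(a\cdot b)\cdot\alpha(c)-\alpha(a)\cdot(b\cdot c)=(b\cdot a)\cdot\alpha(c)-\alpha(b)\cdot(a\cdot c)$ and $\alpha(a\cdot b)=\alpha(a)\cdot\alpha(b)$; it is regular if $\alpha$ is invertible (standing assumption). A finite group $G$ acts on $A$ if there is a map $G\times A\to A$, $(g,a)\mapsto ga=\psi_g(a)$, with each $\psi_g$ linear, $ea=a$, $(g_1g_2)a=g_1(g_2a)$, $g(a\cdot b)=ga\cdot gb$ and $\alpha(ga)=g\alpha(a)$. For $H\le G$, $A^H=\{a\in A\mid ha=a\ \forall h\in H\}$ is a sub Hom-pre-Lie algebra. If $g^{-1}Hg\subseteq K$ (with $g\in G$, $H,K\le G$), then $\psi_g$ restricts to a map $A^K\to A^H$. An equivariant one-parameter formal deformation of $A$ is a family $(\mathfrak{v}_t,\mathfrak{a}_t)=\{(\nu^H_t,\alpha^H_t)\}_{H\le G}$ of $\mathbb{K}[[t]]$-bilinear maps $\nu^H_t=\sum_{i\ge0}\nu^H_it^i$ and $\mathbb{K}[[t]]$-linear maps $\alpha^H_t=\sum_{i\ge0}\alpha^H_it^i$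 on $A^H[[t]]$, with $\nu^H_i$ $\mathbb{K}$-bilinear and $\alpha^H_i$ $\mathbb{K}$-linear on $A^H$, such that for all $H\le G$ and $a,b,c\in A^H$: $\nu^H_0(a,b)=a\cdot b$, $\alpha^H_0(a)=\alpha(a)$; $\nu^H_t(\nu^H_t(a,b),\alpha^H_t(c))-\nu^H_t(\alpha^H_t(a),\nu^H_t(b,c))=\nu^H_t(\nu^H_t(b,a),\alpha^H_t(c))-\nu^H_t(\alpha^H_t(b),\nu^H_t(a,c))$; $\nu^H_t(\alpha^H_t(a),\alpha^H_t(b))=\alpha^H_t(\nu^H_t(a,b))$; and whenever $g^{-1}Hg\subseteq K$, $\nu^H_t\circ(\psi_g\otimes\psi_g)=\psi_g\circ\nu^K_t$ and $\alpha^H_t\circ\psi_g=\psi_g\circ\alpha^K_t$ on $A^K$. Two equivariant deformations $\{(\nu^H_t,\alpha^H_t)\}$ and $\{((\nu'_t)^H,(\alpha'_t)^H)\}$ are equivalent if for every $H\le G$ there is a $\mathbb{K}[[t]]$-isomorphism $\Psi^H_t=\sum_{i\ge0}\psi^H_it^i:A^H[[t]]\to A^H[[t]]$ with $\psi^H_i:A^H\to A^H$ $\mathbb{K}$-linear, $\psi^H_0=\mathrm{id}$, $\Psi^H_t\circ(\nu'_t)^H=\nu^H_t\circ(\Psi^H_t\otimes\Psi^H_t)$ and $\alpha^H_t\circ\Psi^H_t=\Psi^H_t\circ(\alpha'_t)^H$. An equivariant deformation is trivial if it is equivalent to $(\mathfrak{v}_0,\mathfrak{a}_0)=\{(\nu^H_0,\alpha^H_0)\}$;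 $A$ with its $G$-action is (equivariantly) rigid if all its equivariant deformations are trivial. Equivariant $\alpha$-type cohomology in degree 2: for a Hom-pre-Lie algebra $B$, $\widetilde C^1(B,B)=\mathrm{Hom}(B,B)$, $\widetilde C^2(B,B)=\mathrm{Hom}(B^{\otimes2},B)\oplus\mathrm{Hom}(B,B)$, $\widetilde C^3(B,B)=\mathrm{Hom}(B^{\otimes3},B)\oplus\mathrm{Hom}(B^{\otimes2},B)$. $\widetilde\partial:\widetilde C^1\to\widetilde C^2$ sends $\phi$ to the pair of $(a,b)\mapsto a\cdot\phi(b)+\phi(a)\cdot b-\phi(a\cdot b)$ and $a\mapsto\alpha(\phi(a))-\phi(\alpha(a))$. $\widetilde\partial:\widetilde C^2\to\widetilde C^3$ is $\widetilde\partial(\varphi,\psi)=(\widetilde\partial_{\nu\nu}\varphi-\widetilde\partial_{\alpha\nu}\psi,\ \widetilde\partial_{\nu\alpha}\varphi-\widetilde\partial_{\alpha\alpha}\psi)$ with $(\widetilde\partial_{\nu\nu}\varphi)(a,b,c)=\alpha(a)\cdot\varphi(b,c)-\alpha(b)\cdot\varphi(a,c)+\varphi(b,a)\cdot\alpha(c)-\varphi(a,b)\cdot\alpha(c)-\varphi(\alpha(b),a\cdot c)+\varphi(\alpha(a),b\cdot c)-\varphi(a\cdot b,\alpha(c))+\varphi(b\cdot a,\alpha(c))$; $(\widetilde\partial_{\alpha\nu}\psi)(a,b,c)=\psi(b)\cdot(a\cdot c)-\psi(a)\cdot(b\cdot c)+(a\cdot b)\cdot\psi(c)-(b\cdot a)\cdot\psi(c)$;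 $(\widetilde\partial_{\nu\alpha}\varphi)(a,b)=\alpha(\varphi(a,b))-\varphi(\alpha(a),\alpha(b))$; $(\widetilde\partial_{\alpha\alpha}\psi)(a,b)=\alpha(a)\cdot\psi(b)+\psi(a)\cdot\alpha(b)-\psi(a\cdot b)$. $S^m_G$ is the space of families $c=\{(c^H_\nu,c^H_\alpha)\}_{H\le G}\in\bigoplus_{H\le G}\widetilde C^m(A^H,A^H)$ (with $c^H_\alpha=0$ when $m=1$) that are invariant: whenever $g^{-1}Hg\subseteq K$, $c^H_\nu\circ\psi_g^{\otimes m}=\psi_g\circ c^K_\nu$ and $c^H_\alpha\circ\psi_g^{\otimes(m-1)}=\psi_g\circ c^K_\alpha$ on tensor powers of $A^K$. $\delta$ applies $\widetilde\partial$ of $A^H$ in each component $H$. $\widetilde H^2_G(A,A)=\ker(\delta:S^2_G\to S^3_G)/\delta(S^1_G)$. *)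

(* Defs.v *)
From HB Require Import structures.
From mathcomp Require Import all_boot all_order all_fingroup all_algebra.

Set Implicit Arguments.
Unset Strict Implicit.
Unset Printing Implicit Defensive.

Import GRing.Theory.
Local Open Scope ring_scope.

Notation is_bilinear f := (bilinear_for *:%R *:%R f).

HB.mixin Record Lmodule_isHomPreLie (K : fieldType) A of GRing.Lmodule K A := {
  hmul : A -> A -> A;
  halpha : A -> A;
  hmul_bilinear : is_bilinear hmul;
  halpha_linear : linear halpha;
  hom_pre_lie : forall a b c : A,
    hmul (hmul a b) (halpha c) - hmul (halpha a) (hmul b c) =
    hmul (hmul b a) (halpha c) - hmul (halpha b) (hmul a c);
  halphaM : forall a b : A, halpha (hmul a b) = hmul (halpha a) (halpha b)
}.

#[short(type="homPreLieType")]
HB.structure Definition HomPreLie (K : fieldType) :=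
  {A of GRing.Lmodule K A & Lmodule_isHomPreLie K A}.

Infix "·" := hmul (at level 40, left associativity) : ring_scope.

HB.instance Definition _ (K : fieldType) (A : homPreLieType K) :=
  GRing.isLinear.Build K A A *:%R (@halpha K A) halpha_linear.
HB.instance Definition _ (K : fieldType) (A : homPreLieType K) :=
  bilinear_isBilinear.Build K A A A *:%R *:%R (@hmul K A) hmul_bilinear.

Definition regular (K : fieldType) (A : homPreLieType K) : Prop :=
  bijective (@halpha K A).

(* Left actions; the actions of MathComp's action.v are right actions. *)
Record hpl_action (K : fieldType) (gT : finGroupType) (A : homPreLieType K) :=
  HplAction {
    hact :> gT -> A -> A;
    hact_linear : forall g, linear (hact g);
    hact1 : forall a, hact 1%g a = a;
    hactM : forall g1 g2 a, hact (g1 * g2)%g a = hact g1 (hact g2 a);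
    hact_mul : forall g a b, hact g (a · b) = hact g a · hact g b;
    hact_alpha : forall g a, halpha (hact g a) = hact g (halpha a)
  }.

Section FixedPoints.

Variables (K : fieldType) (gT : finGroupType) (A : homPreLieType K).
Variables (psi : hpl_action gT A) (H : {group gT}).

Definition is_fixed : {pred A} := [pred a | [forall h in H, psi h a == a]].

Lemma is_fixedP a : reflect (forall h, h \in H -> psi h a = a) (a \in is_fixed).
Proof. exact: 'forall_in_eqP. Qed.

Lemma is_fixed_submod : submod_closed is_fixed.
Proof.
split=> [|k a b /is_fixedP Ha /is_fixedP Hb]; apply/is_fixedP => h hH.
  have := hact_linear psi h (-1) 0 0; rewrite scaler0 addr0 scaleN1r.
  by rewrite addNr.
by rewrite (hact_linear psi h) Ha ?Hb.
Qed.

HB.instance Definition _ := GRing.isSubmodClosed.Build K A is_fixed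
  is_fixed_submod.

Record fixed := Fixed { fixed_val : A; _ : fixed_val \in is_fixed }.

HB.instance Definition _ := [isSub for fixed_val].
HB.instance Definition _ := [Choice of fixed by <:].
HB.instance Definition _ := [SubChoice_isSubLmodule of fixed by <:].

Lemma is_fixed_mul (a b : fixed) : val a · val b \in is_fixed.
Proof.
by apply/is_fixedP => h hH; rewrite hact_mul !(is_fixedP _ (valP _)).
Qed.

Lemma is_fixed_alpha (a : fixed) : halpha (val a) \in is_fixed.
Proof.
by apply/is_fixedP => h hH; rewrite -hact_alpha (is_fixedP _ (valP _)).
Qed.

Definition fixed_mul (a b : fixed) : fixed := Fixed (is_fixed_mul a b).
Definition fixed_alpha (a : fixed) : fixed := Fixed (is_fixed_alpha a).

Lemma fixed_mul_bilinear : is_bilinear fixed_mul.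
Proof.
split=> [u' k u v|u k v v']; apply: val_inj; rewrite linearP /=.
  exact: (hmul_bilinear (s := A)).1.
exact: (hmul_bilinear (s := A)).2.
Qed.

Lemma fixed_alpha_linear : linear fixed_alpha.
Proof.
by move=> k u v; apply: val_inj; rewrite linearP /=; exact: halpha_linear.
Qed.

Lemma fixed_hom_pre_lie a b c :
  fixed_mul (fixed_mul a b) (fixed_alpha c)
    - fixed_mul (fixed_alpha a) (fixed_mul b c) =
  fixed_mul (fixed_mul b a) (fixed_alpha c)
    - fixed_mul (fixed_alpha b) (fixed_mul a c).
Proof. by apply: val_inj; rewrite !linearB /=; exact: hom_pre_lie. Qed.

Lemma fixed_alphaM a b :
  fixed_alpha (fixed_mul a b) = fixed_mul (fixed_alpha a) (fixed_alpha b).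
Proof. by apply: val_inj; exact: halphaM. Qed.

HB.instance Definition _ := Lmodule_isHomPreLie.Build K fixed
  fixed_mul_bilinear fixed_alpha_linear fixed_hom_pre_lie fixed_alphaM.

End FixedPoints.

(* [H :^ g] is g^-1 H g. *)
Section Restriction.

Variables (K : fieldType) (gT : finGroupType) (A : homPreLieType K).
Variables (psi : hpl_action gT A) (g : gT) (H L : {group gT}).
Hypothesis sHL : (H :^ g)%g \subset L.

Lemma is_fixed_res (a : fixed psi L) : psi g (val a) \in is_fixed psi H.
Proof.
apply/is_fixedP => h hH; rewrite -hactM conjgC hactM.
by rewrite (is_fixedP _ _ _ (valP a)) // (subsetP sHL) ?memJ_conjg.
Qed.

Definition res_act (a : fixed psi L) : fixed psi H := Fixed (is_fixed_res a).

End Restriction.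

(* V[[t]] is the type of coefficient sequences [nat -> V].  A family of        *)
(* K-linear (K-bilinear) coefficients f_i is extended to the K[[t]]-linear     *)
(* (K[[t]]-bilinear) map given by the sum of the f_i t^i.                      *)
Section PowerSeries.

Variables (K : fieldType) (U V W : lmodType K).

Definition pconst (v : V) : nat -> V := fun n => if n is _.+1 then 0 else v.

Definition pext1 (f : nat -> U -> V) (x : nat -> U) : nat -> V :=
  fun n => \sum_(i < n.+1) f i (x (n - i)%N).

Definition pext2 (f : nat -> U -> V -> W) (x : nat -> U) (y : nat -> V) :
    nat -> W :=
  fun n => \sum_(i < n.+1) \sum_(j < (n - i).+1) f i (x j) (y (n - i - j)%N).

End PowerSeries.

Section Deformations.

Variables (K : fieldType) (gT : finGroupType) (A : homPreLieType K).
Variable psi : hpl_action gT A.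

Record equivariant_deformation := EquivariantDeformation {
  def_mul : forall H : {group gT},
    nat -> fixed psi H -> fixed psi H -> fixed psi H;
  def_alpha : forall H : {group gT}, nat -> fixed psi H -> fixed psi H;
  def_mul_bilinear : forall H i, is_bilinear (@def_mul H i);
  def_alpha_linear : forall H i, linear (@def_alpha H i);
  def_mul0 : forall H (a b : fixed psi H), def_mul 0 a b = a · b;
  def_alpha0 : forall H (a : fixed psi H), def_alpha 0 a = halpha a;
  def_hom_pre_lie : forall (H : {group gT}) (a b c : fixed psi H),
    let nu := pext2 (@def_mul H) in let al := pext1 (@def_alpha H) in
    let a := pconst a in let b := pconst b in let c := pconst c in
    nu (nu a b) (al c) \- nu (al a) (nu b c) =1
    nu (nu b a) (al c) \- nu (al b) (nu a c);
  def_alphaM : forall (H : {group gT}) (a b : fixed psi H),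
    let nu := pext2 (@def_mul H) in let al := pext1 (@def_alpha H) in
    let a := pconst a in let b := pconst b in
    nu (al a) (al b) =1 al (nu a b);
  def_mul_act : forall g (H L : {group gT}) (sHL : (H :^ g)%g \subset L)
      (a b : fixed psi L),
    pext2 (@def_mul H) (pconst (res_act sHL a)) (pconst (res_act sHL b)) =1
    res_act sHL \o pext2 (@def_mul L) (pconst a) (pconst b);
  def_alpha_act : forall g (H L : {group gT}) (sHL : (H :^ g)%g \subset L)
      (a : fixed psi L),
    pext1 (@def_alpha H) (pconst (res_act sHL a)) =1
    res_act sHL \o pext1 (@def_alpha L) (pconst a)
}.

Definition equivalent (D D' : equivariant_deformation) : Prop :=
  forall H : {group gT},
    exists Psi : nat -> fixed psi H -> fixed psi H,
      [/\ forall i, linear (Psi i),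
          forall a, Psi 0 a = a,
          bijective (pext1 Psi),
          forall x y : nat -> fixed psi H,
            pext1 Psi (pext2 (@def_mul D' H) x y) =1
            pext2 (@def_mul D H) (pext1 Psi x) (pext1 Psi y) &
          forall x : nat -> fixed psi H,
            pext1 (@def_alpha D H) (pext1 Psi x) =1
            pext1 Psi (pext1 (@def_alpha D' H) x)].

End Deformations.

Section TrivialDeformation.

Variables (K : fieldType) (gT : finGroupType) (A : homPreLieType K).
Variable psi : hpl_action gT A.

Definition triv_mul (H : {group gT}) i (a b : fixed psi H) : fixed psi H :=
  if i is _.+1 then 0 else a · b.
Definition triv_alpha (H : {group gT}) i (a : fixed psi H) : fixed psi H :=
  if i is _.+1 then 0 else halpha a.

Lemma triv_mul_bilinear H i : is_bilinear (@triv_mul H i).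
Proof.
case: i => [|i]; first exact: hmul_bilinear.
by split=> u k x y; rewrite [RHS]addr0 [RHS]scaler0.
Qed.

Lemma triv_alpha_linear H i : linear (@triv_alpha H i).
Proof.
case: i => [|i]; first exact: halpha_linear.
by move=> k x y; rewrite [RHS]addr0 [RHS]scaler0.
Qed.

Lemma pext1_triv H x (a : fixed psi H) : x =1 pconst a ->
  pext1 (@triv_alpha H) x =1 pconst (halpha a).
Proof.
move=> xa n; rewrite /pext1 big_ord_recl big1 // addr0 subn0 xa.
by case: n => // n; exact: linear0.
Qed.

Lemma pext2_triv H x y (a b : fixed psi H) :
  x =1 pconst a -> y =1 pconst b ->
  pext2 (@triv_mul H) x y =1 pconst (a · b).
Proof.
move=> xa yb n; rewrite /pext2 big_ord_recl [X in _ + X]big1 => [|i _]; last first.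
  by rewrite big1.
rewrite addr0 subn0 big_ord_recl big1 => [|i _].
  by rewrite addr0 xa subn0 yb; case: n => // n; exact: linear0r.
by rewrite xa; exact: linear0l.
Qed.

Lemma triv_hom_pre_lie (H : {group gT}) (a b c : fixed psi H) :
  let nu := pext2 (@triv_mul H) in let al := pext1 (@triv_alpha H) in
  let a := pconst a in let b := pconst b in let c := pconst c in
  nu (nu a b) (al c) \- nu (al a) (nu b c) =1
  nu (nu b a) (al c) \- nu (al b) (nu a c).
Proof.
move=> nu al a' b' c' n.
have nuE x y x' y' : x' =1 pconst x -> y' =1 pconst y ->
  nu x' y' =1 pconst (x · y) by exact: pext2_triv.
have alE x x' : x' =1 pconst x -> al x' =1 pconst (halpha x).
  exact: pext1_triv.
have [ra rb rc] : [/\ a' =1 pconst a, b' =1 pconst b & c' =1 pconst c] by [].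
rewrite /= (nuE _ _ _ _ (nuE _ _ _ _ ra rb) (alE _ _ rc)).
rewrite (nuE _ _ _ _ (alE _ _ ra) (nuE _ _ _ _ rb rc)).
rewrite (nuE _ _ _ _ (nuE _ _ _ _ rb ra) (alE _ _ rc)).
rewrite (nuE _ _ _ _ (alE _ _ rb) (nuE _ _ _ _ ra rc)).
by case: n => [|n] //; exact: hom_pre_lie.
Qed.

Lemma triv_alphaM (H : {group gT}) (a b : fixed psi H) :
  let nu := pext2 (@triv_mul H) in let al := pext1 (@triv_alpha H) in
  let a := pconst a in let b := pconst b in
  nu (al a) (al b) =1 al (nu a b).
Proof.
move=> nu al a' b' n.
rewrite /nu (@pext2_triv _ _ _ (halpha a) (halpha b)); try exact: pext1_triv.
rewrite /al (@pext1_triv _ _ (a · b)); last exact: pext2_triv.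
by rewrite halphaM.
Qed.

Lemma res_act0 g (H L : {group gT}) (sHL : (H :^ g)%g \subset L) :
  res_act (psi := psi) sHL 0 = 0.
Proof.
apply: val_inj; rewrite [RHS]raddf0 -[LHS]/(psi g (val _)) [val _]raddf0.
by have := hact_linear psi g (-1) 0 0; rewrite scaler0 addr0 scaleN1r addNr.
Qed.

Lemma triv_mul_act g (H L : {group gT}) (sHL : (H :^ g)%g \subset L)
    (a b : fixed psi L) :
  pext2 (@triv_mul H) (pconst (res_act sHL a)) (pconst (res_act sHL b)) =1
  res_act sHL \o pext2 (@triv_mul L) (pconst a) (pconst b).
Proof.
move=> n /=; rewrite !(pext2_triv (frefl _) (frefl _)).
case: n => [|n]; last by rewrite /= res_act0.
by apply: val_inj; rewrite /= hact_mul.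
Qed.

Lemma triv_alpha_act g (H L : {group gT}) (sHL : (H :^ g)%g \subset L)
    (a : fixed psi L) :
  pext1 (@triv_alpha H) (pconst (res_act sHL a)) =1
  res_act sHL \o pext1 (@triv_alpha L) (pconst a).
Proof.
move=> n /=; rewrite !(pext1_triv (frefl _)).
case: n => [|n]; last by rewrite /= res_act0.
by apply: val_inj; rewrite /= hact_alpha.
Qed.

Definition trivial_deformation : equivariant_deformation psi :=
  EquivariantDeformation triv_mul_bilinear triv_alpha_linear
    (fun _ _ _ => erefl) (fun _ _ => erefl)
    triv_hom_pre_lie triv_alphaM triv_mul_act triv_alpha_act.

Definition equivariantly_rigid : Prop :=
  forall D : equivariant_deformation psi, equivalent D trivial_deformation.

End TrivialDeformation.

Section Cochains.

Variables (K : fieldType) (B : homPreLieType K).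

(* Cochains are pairs of maps (c_nu, c_alpha); multilinearity is imposed       *)
(* separately.  In degree 1 the component c_alpha is zero and is left out.     *)
Definition cochain1 := B -> B.
Definition cochain2 := ((B -> B -> B) * (B -> B))%type.
Definition cochain3 := ((B -> B -> B -> B) * (B -> B -> B))%type.

Definition multilinear1 (f : cochain1) : Prop := linear f.

Definition multilinear2 (c : cochain2) : Prop := is_bilinear c.1 /\ linear c.2.

Definition d1 (f : cochain1) : cochain2 :=
  (fun a b => a · f b + f a · b - f (a · b),
   fun a => halpha (f a) - f (halpha a)).

Definition d_nunu (phi : B -> B -> B) (a b c : B) : B :=
  halpha a · phi b c - halpha b · phi a c + phi b a · halpha c
  - phi a b · halpha c - phi (halpha b) (a · c) + phi (halpha a) (b · c)
  - phi (a · b) (halpha c) + phi (b · a) (halpha c).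

Definition d_alnu (psi : B -> B) (a b c : B) : B :=
  psi b · (a · c) - psi a · (b · c) + (a · b) · psi c - (b · a) · psi c.

Definition d_nual (phi : B -> B -> B) (a b : B) : B :=
  halpha (phi a b) - phi (halpha a) (halpha b).

Definition d_alal (psi : B -> B) (a b : B) : B :=
  halpha a · psi b + psi a · halpha b - psi (a · b).

Definition d2 (c : cochain2) : cochain3 :=
  (fun x y z => d_nunu c.1 x y z - d_alnu c.2 x y z,
   fun x y => d_nual c.1 x y - d_alal c.2 x y).

End Cochains.

Section EquivariantCohomology.

Variables (K : fieldType) (gT : finGroupType) (A : homPreLieType K).
Variable psi : hpl_action gT A.

Definition family1 := forall H : {group gT}, cochain1 (fixed psi H).
Definition family2 := forall H : {group gT}, cochain2 (fixed psi H).
Definition family3 := forall H : {group gT}, cochain3 (fixed psi H).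

Definition in_S1 (f : family1) : Prop :=
  (forall H, multilinear1 (f H)) /\
  (forall g (H L : {group gT}) (sHL : (H :^ g)%g \subset L) a,
     f H (res_act sHL a) = res_act sHL (f L a)).

Definition in_S2 (c : family2) : Prop :=
  (forall H, multilinear2 (c H)) /\
  (forall g (H L : {group gT}) (sHL : (H :^ g)%g \subset L),
     (forall a b, (c H).1 (res_act sHL a) (res_act sHL b) =
                  res_act sHL ((c L).1 a b)) /\
     (forall a, (c H).2 (res_act sHL a) = res_act sHL ((c L).2 a))).

Definition delta1 (f : family1) : family2 := fun H => d1 (f H).
Definition delta2 (c : family2) : family3 := fun H => d2 (c H).

Definition cocycle2 (c : family2) : Prop :=
  in_S2 c /\
  (forall H, (forall x y z, (delta2 c H).1 x y z = 0) /\
             (forall x y, (delta2 c H).2 x y = 0)).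

Definition coboundary2 (c : family2) : Prop :=
  exists2 f, in_S1 f &
    forall H, (forall a b, (c H).1 a b = (delta1 f H).1 a b) /\
              (forall a, (c H).2 a = (delta1 f H).2 a).

(* As im(delta1) is contained in ker(delta2), the quotient ker / im is zero    *)
(* iff ker is contained in im.                                                 *)
Definition H2_vanishes : Prop := forall c, cocycle2 c -> coboundary2 c.

End EquivariantCohomology.

(* Main.v *)
Require Import Defs.
From HB Require Import structures.
From mathcomp Require Import all_boot all_order all_fingroup all_algebra.
From mathcomp Require Import boolp functions.

(** Trivializing a deformation D means finding, for each subgroup H, a series
    p^H = id + p_1^H t + p_2^H t^2 + ... that intertwines the undeformed
    structure of A^H with the deformed one.  The coefficients are found one
    degree at a time, for all subgroups simultaneously and invariantly under
    the restrictions of the action.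

    Write N and A for the deformed product and twist on A^H[[t]], and P(a) for
    the series p(a).  Suppose that p_0, ..., p_(n-1) are invariant families such
    that N(P a, P b) = P(a b) and A(P a) = P(alpha a) modulo t^n, and put
    p_n := 0.  The failures of these two equations in degree n form a 2-cochain
    c = (N(P a, P b)_n, A(P a)_n).  Substituting P a, P b, P c into the
    Hom-pre-Lie identity of D and comparing coefficients of t^n leaves exactly
    the first component of the cocycle equation for c; the multiplicativity of
    A gives the second one (obstruction_cocycle).  Since D is equivariant and
    the p_i are invariant, c is an equivariant cocycle, hence c = delta f with
    f invariant, and p_n := - f corrects degree n while keeping invariance
    (trivializes_step).

    Two facts about power series support this.  A K[[t]]-linear map of V[[t]] is
    determined by its values on V (tlinear_ext), which lets identities be moved
    between constants and arbitrary series; and a change of the arguments in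
    degrees >= n only affects the n-th coefficient through the undeformed
    operations (pext1_congr, pext2_congr).  The infinitely many choices of the
    p_n are made by dependent choice (dependent_choice_prefix), and a series
    starting with the identity is invertible (pext1_bijective). *)

Set Implicit Arguments.
Unset Strict Implicit.
Unset Printing Implicit Defensive.

Import GRing.Theory.
Local Open Scope ring_scope.

(** * Dependent choice *)

(** A sequence can be built entry by entry as soon as the n-th requirement only
    looks at the entries up to n: fulfilled requirements then survive all later
    choices. *)
Lemma dependent_choice_prefix (T : Type) (t0 : T)
    (R : nat -> (nat -> T) -> Prop) :
  (forall n p p', (forall k, (k <= n)%N -> p k = p' k) -> R n p -> R n p') ->
  (forall n p, (forall k, (k < n)%N -> R k p) ->
     exists y, R n (fun k => if k == n then y else p k)) ->
  exists p, forall n, R n p.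
Proof.
move=> Rloc step.
pose upd n (p : nat -> T) y k := if k == n then y else p k.
have /choice[next nextP] (np : nat * (nat -> T)) : exists y,
    (forall k, (k < np.1)%N -> R k np.2) -> R np.1 (upd np.1 np.2 y).
  case: np => n p /=.
  have [/step [y Ry]|nR] := pselect (forall k, (k < n)%N -> R k p).
    by exists y.
  by exists t0 => /nR.
(* [stage n] has its first n entries in their final form. *)
pose fix stage n := if n is m.+1 then upd m (stage m) (next (m, stage m))
                    else fun=> t0.
have stageS n k : (k <= n)%N -> stage n.+1 k = stage k.+1 k.
  elim: n => [|n IHn]; first by rewrite leqn0 => /eqP->.
  rewrite leq_eqVlt => /predU1P[-> //|lekn].
  by rewrite -IHn // [LHS]/= {1}/upd ltn_eqF.
have stageR n : forall k, (k < n)%N -> R k (stage n).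
  elim: n => // n IHn k; rewrite ltnS leq_eqVlt => /predU1P[->|ltkn].
    exact: (nextP (n, stage n)).
  apply: Rloc (IHn k ltkn) => j lejk.
  by rewrite [RHS]/= /upd ltn_eqF // (leq_ltn_trans lejk).
exists (fun k => stage k.+1 k) => n.
by apply: Rloc (stageR n.+1 n (ltnSn n)) => k /stageS.
Qed.

(** * K[[t]]-linear maps between spaces of power series *)

(** Multiplication by t. *)
Definition pshift (V : nmodType) (x : nat -> V) : nat -> V :=
  fun n => if n is m.+1 then x m else 0.

Lemma linear_map0 (K : fieldType) (U V : lmodType K) (f : U -> V) :
  linear f -> f 0 = 0.
Proof.
by move=> linf; have := linf (-1) 0 0; rewrite scaler0 addr0 scaleN1r addNr.
Qed.

Lemma series_split (K : fieldType) (V : lmodType K) (x : nat -> V) :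
  x = pconst (x 0) + pshift (fun n => x n.+1).
Proof. by apply/funext => -[|n]; rewrite !fctE /= ?addr0 ?add0r. Qed.

(** K-linearity and commutation with t already give K[[t]]-linearity: the n-th
    coefficient of the image depends only on the first n + 1 coefficients of
    the argument, so infinite sums over powers of t are respected. *)
Definition tlinear (K : fieldType) (U V : lmodType K)
    (F : (nat -> U) -> (nat -> V)) : Prop :=
  linear F /\ {morph F : x / pshift x}.

Section TLinear.

Variables (K : fieldType) (U V W : lmodType K).
Implicit Types F G : (nat -> U) -> (nat -> V).

Lemma tlinearD F : tlinear F -> {morph F : x y / x + y}.
Proof. by case=> linF _ x y; have := linF 1 x y; rewrite !scale1r. Qed.

Lemma tlinearB F : tlinear F -> {morph F : x y / x - y}.
Proof.
by case=> linF _ x y; have := linF (-1) y x; rewrite !scaleN1r !(addrC (- _)).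
Qed.

Lemma tlinear_comp (E : (nat -> V) -> (nat -> W)) F :
  tlinear E -> tlinear F -> tlinear (fun x => E (F x)).
Proof.
move=> [linE shE] [linF shF]; split=> [k x y|x]; first by rewrite linF linE.
by rewrite shF shE.
Qed.

Lemma tlinear_sub F G :
  tlinear F -> tlinear G -> tlinear (fun x => F x - G x).
Proof.
move=> [linF shF] [linG shG]; split=> [k x y|x].
  by rewrite linF linG scalerBr opprD addrACA.
by rewrite shF shG; apply/funext => -[|n] //=; rewrite !fctE subr0.
Qed.

(** Induction on the degree, along x = x_0 + t x': the coefficient of t^(n+1) in
    t F(x') is the coefficient of t^n in F(x'). *)
Lemma tlinear_ext F G : tlinear F -> tlinear G ->
  (forall a, F (pconst a) = G (pconst a)) -> F =1 G.
Proof.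
move=> tF tG eqFG x; apply/funext => n.
elim: n x => [|n IHn] x; rewrite [x]series_split.
  by rewrite (tlinearD tF) (tlinearD tG) tF.2 tG.2 eqFG.
by rewrite (tlinearD tF) (tlinearD tG) tF.2 tG.2 eqFG !fctE /= IHn.
Qed.

(** Such an x is t^n times a series, and F commutes with t^n. *)
Lemma tlinear_lead F n x : tlinear F -> (forall i, (i < n)%N -> x i = 0) ->
  F x n = F (fun k => x (n + k)%N) 0.
Proof.
move=> tF; elim: n x => [//|n IHn] x x0.
have {1}-> : x = pshift (fun k => x k.+1).
  by apply/funext => -[|m] //=; rewrite x0.
by rewrite tF.2 /= IHn // => i ltin; rewrite x0.
Qed.

Lemma tlinear_congr F n x x' : tlinear F ->
  (forall i, (i < n)%N -> x i = x' i) ->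
  F x n = F x' n + F (fun k => x (n + k)%N - x' (n + k)%N) 0.
Proof.
move=> tF eqx; rewrite -(@tlinear_lead F n (x - x')) //.
  by rewrite (tlinearB tF) !fctE addrCA subrr addr0.
by move=> i ltin; rewrite !fctE eqx ?subrr.
Qed.

End TLinear.

(** * K[[t]]-multilinear extensions of families of coefficients *)

(** The common reason why [pext1] and [pext2] commute with t: delaying every
    term of an antidiagonal sum delays the sum. *)
Lemma sum_antidiag_shift (V : nmodType) (w : nat -> nat -> V) n :
  \sum_(i < n.+1) pshift (w i) (n - i)%N =
  pshift (fun m => \sum_(i < m.+1) w i (m - i)%N) n.
Proof.
case: n => [|n]; first by rewrite big_ord1.
rewrite big_ord_recr /= subnn addr0; apply: eq_bigr => i _.
by rewrite subSn ?leq_ord.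
Qed.

Section Extensions.

Variables (K : fieldType) (U V W : lmodType K).

Lemma pext1_tlinear (f : nat -> U -> V) :
  (forall i, linear (f i)) -> tlinear (pext1 f).
Proof.
move=> linf; split=> [k x y|x]; apply/funext => n.
  rewrite !fctE /pext1 scaler_sumr -big_split.
  by apply: eq_bigr => i _; rewrite linf.
rewrite -(sum_antidiag_shift (fun i m => f i (x m))).
apply: eq_bigr => i _.
by case: (n - i)%N => //=; apply: linear_map0.
Qed.

Section Bilinear.

Variable f : nat -> U -> V -> W.
Hypothesis bilf : forall i, is_bilinear (f i).

Lemma bil0l i v : f i 0 v = 0.
Proof. exact: linear_map0 ((bilf i).1 v). Qed.

Lemma bil0r i u : f i u 0 = 0.
Proof. exact: linear_map0 ((bilf i).2 u). Qed.

Lemma pext2_tlinearl y : tlinear (pext2 f ^~ y).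
Proof.
split=> [k x x'|x]; apply/funext => n.
  rewrite !fctE /pext2 scaler_sumr -big_split.
  apply: eq_bigr => i _; rewrite scaler_sumr -big_split.
  by apply: eq_bigr => j _; rewrite (bilf i).1.
rewrite -(sum_antidiag_shift (fun i m =>
  \sum_(j < m.+1) f i (x j) (y (m - j)%N))).
apply: eq_bigr => i _.
case: (n - i)%N => [|m] /=; first by rewrite big_ord1 bil0l.
by rewrite big_ord_recl /= bil0l add0r.
Qed.

Lemma pext2_tlinearr x : tlinear (pext2 f x).
Proof.
split=> [k y y'|y]; apply/funext => n.
  rewrite !fctE /pext2 scaler_sumr -big_split.
  apply: eq_bigr => i _; rewrite scaler_sumr -big_split.
  by apply: eq_bigr => j _; rewrite (bilf i).2.
rewrite -(sum_antidiag_shift (fun i m =>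
  \sum_(j < m.+1) f i (x j) (y (m - j)%N))).
apply: eq_bigr => i _.
case: (n - i)%N => [|m] /=; first by rewrite big_ord1 bil0r.
rewrite big_ord_recr /= subnn bil0r addr0.
by apply: eq_bigr => j _; rewrite subSn ?leq_ord.
Qed.

Lemma pext2_coef0 x y : pext2 f x y 0 = f 0 (x 0) (y 0).
Proof. by rewrite /pext2 !big_ord1. Qed.

Lemma pext2_pconst a b n : pext2 f (pconst a) (pconst b) n = f n a b.
Proof.
rewrite /pext2 big_ord_recr big1 => [|i _] /=.
  by rewrite add0r subnn big_ord1.
rewrite big_ord_recl big1 => [|j _] /=; last by rewrite bil0l.
by rewrite addr0 subn0 -[(n - i)%N]prednK ?subn_gt0 //= bil0r.
Qed.

(** A change of one argument by a multiple of t^n reaches the n-th coefficient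
    only paired with the constant terms of f and of the other argument. *)
Lemma pext2_congr n x x' y y' :
  (forall i, (i < n)%N -> x i = x' i) -> (forall i, (i < n)%N -> y i = y' i) ->
  pext2 f x y n = pext2 f x' y' n + f 0 (x n - x' n) (y 0)
                                  + f 0 (x' 0) (y n - y' n).
Proof.
move=> eqx eqy; rewrite (tlinear_congr (pext2_tlinearl y) eqx).
rewrite (tlinear_congr (pext2_tlinearr x') eqy) addrAC.
by rewrite !pext2_coef0 !addn0.
Qed.

End Bilinear.

Lemma pext1_coef0 (f : nat -> U -> V) x : pext1 f x 0 = f 0 (x 0).
Proof. by rewrite /pext1 big_ord1. Qed.

Lemma pext1_pconst (f : nat -> U -> V) a n :
  (forall i, linear (f i)) -> pext1 f (pconst a) n = f n a.
Proof.
move=> linf; rewrite /pext1 big_ord_recr big1 => [|i _] /=.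
  by rewrite add0r subnn.
by rewrite -[(n - i)%N]prednK ?subn_gt0 //=; apply: linear_map0.
Qed.

Lemma pext1_congr (f : nat -> U -> V) n x x' :
  (forall i, linear (f i)) -> (forall i, (i < n)%N -> x i = x' i) ->
  pext1 f x n = pext1 f x' n + f 0 (x n - x' n).
Proof.
move=> linf eqx; rewrite (tlinear_congr (pext1_tlinear linf) eqx).
by rewrite pext1_coef0 addn0.
Qed.

End Extensions.

(** The equation [pext1 p x = y] reads [x n = y n - ...], where the dots involve
    only earlier coefficients of x; it is solved degree by degree. *)
Lemma pext1_bijective (K : fieldType) (V : lmodType K) (p : nat -> V -> V) :
  (forall a, p 0 a = a) -> bijective (pext1 p).
Proof.
move=> p0.
have pE x n : pext1 p x n = x n + \sum_(i < n) p i.+1 (x (n - i.+1)%N).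
  by rewrite /pext1 big_ord_recl /= subn0 p0.
have p_inj : injective (pext1 p).
  move=> x x' eqp; apply/funext => n; elim/ltn_ind: n => n IHn.
  have := congr1 (@^~ n) eqp; rewrite !pE => eqn.
  apply: (addIr (\sum_(i < n) p i.+1 (x (n - i.+1)%N))).
  rewrite {}eqn; congr (_ + _); apply: eq_bigr => i _.
  by rewrite IHn // ltn_subrL (leq_ltn_trans _ (ltn_ord i)).
have [||s sP] := @dependent_choice_prefix ((nat -> V) -> V) (fun=> 0)
  (fun n s => forall y, s n y = y n - \sum_(i < n) p i.+1 (s (n - i.+1)%N y)).
- move=> n s s' eqs sn y; rewrite -eqs // sn; congr (_ - _).
  by apply: eq_bigr => i _; rewrite eqs ?leq_subr.
- move=> n s _.
  exists (fun y => y n - \sum_(i < n) p i.+1 (s (n - i.+1)%N y)) => y.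
  rewrite eqxx; congr (_ - _); apply: eq_bigr => i _.
  by rewrite ltn_eqF // ltn_subrL (leq_ltn_trans _ (ltn_ord i)).
have sK y : pext1 p (s ^~ y) = y.
  by apply/funext => n; rewrite pE {1}sP subrK.
by exists (fun y => s ^~ y) => // x; apply: p_inj.
Qed.

(** * From identities on constants to identities on power series *)

Section Identities.

Variables (K : fieldType) (B : lmodType K).
Variables (nu : nat -> B -> B -> B) (al : nat -> B -> B).
Hypotheses (bilnu : forall i, is_bilinear (nu i)).
Hypothesis linal : forall i, linear (al i).

Let N := pext2 nu.
Let A := pext1 al.
Let tNl y : tlinear (N ^~ y) := pext2_tlinearl bilnu y.
Let tNr x : tlinear (N x) := pext2_tlinearr bilnu x.
Let tA : tlinear A := pext1_tlinear linal.

Lemma pext_alphaM :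
  (forall a b, N (A (pconst a)) (A (pconst b)) = A (N (pconst a) (pconst b))) ->
  forall x y, N (A x) (A y) = A (N x y).
Proof.
move=> AN x y.
apply: (tlinear_ext (tlinear_comp (tNl (A y)) tA) (tlinear_comp tA (tNl y))).
move=> a /=.
by apply: (tlinear_ext (tlinear_comp (tNr _) tA) (tlinear_comp tA (tNr _))).
Qed.

Lemma pext_hom_pre_lie :
  (forall a b c, let a := pconst a in let b := pconst b in let c := pconst c in
    N (N a b) (A c) - N (A a) (N b c) = N (N b a) (A c) - N (A b) (N a c)) ->
  forall x y z,
    N (N x y) (A z) - N (A x) (N y z) = N (N y x) (A z) - N (A y) (N x z).
Proof.
move=> hpl x y z.
(* Both sides of the identity are the same trilinear expression with x and y
   exchanged; the three functions single out each of its variables in turn. *)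
pose side1 y z x := N (N x y) (A z) - N (A x) (N y z).
pose side2 x z y := N (N x y) (A z) - N (A x) (N y z).
pose side3 x y z := N (N x y) (A z) - N (A x) (N y z).
have t1 y' z' : tlinear (side1 y' z').
  apply: tlinear_sub; first exact: tlinear_comp (tNl _) (tNl _).
  exact: tlinear_comp (tNl _) tA.
have t2 x' z' : tlinear (side2 x' z').
  apply: tlinear_sub; first exact: tlinear_comp (tNl _) (tNr _).
  exact: tlinear_comp (tNr _) (tNl _).
have t3 x' y' : tlinear (side3 x' y').
  apply: tlinear_sub; first exact: tlinear_comp (tNr _) tA.
  exact: tlinear_comp (tNr _) (tNr _).
apply: (tlinear_ext (t1 y z) (t2 y z)) => a.
apply: (tlinear_ext (t2 (pconst a) z) (t1 (pconst a) z)) => b.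
apply: (tlinear_ext (t3 (pconst a) (pconst b)) (t3 (pconst b) (pconst a))) => c.
exact: hpl.
Qed.

End Identities.

(** * The obstruction cocycle *)

Section Obstruction.

Variables (K : fieldType) (B : homPreLieType K).
Variables (nu : nat -> B -> B -> B) (al : nat -> B -> B).
Hypotheses (bilnu : forall i, is_bilinear (nu i)).
Hypothesis linal : forall i, linear (al i).
Hypothesis nu0 : forall a b, nu 0 a b = a · b.
Hypothesis al0 : forall a, al 0 a = halpha a.

Let N := pext2 nu.
Let A := pext1 al.

Hypothesis hplN : forall x y z,
  N (N x y) (A z) - N (A x) (N y z) = N (N y x) (A z) - N (A y) (N x z).
Hypothesis alphaMN : forall x y, N (A x) (A y) = A (N x y).

Variables (p : nat -> B -> B) (n : nat).
Hypothesis linp : forall i, linear (p i).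
Hypothesis p0 : forall a, p 0 a = a.
Hypothesis n_gt0 : (0 < n)%N.
Hypothesis pn : forall a, p n a = 0.

Let P a := p ^~ a.

Hypothesis P_mul : forall i a b, (i < n)%N -> P (a · b) i = N (P a) (P b) i.
Hypothesis P_alpha : forall i a, (i < n)%N -> A (P a) i = P (halpha a) i.

(** As [p n] vanishes, these are the errors in degree n of the two equations
    that hold in degrees below n by [P_mul] and [P_alpha]. *)
Definition obstruction : cochain2 B :=
  (fun a b => pext2 nu (p ^~ a) (p ^~ b) n, fun a => pext1 al (p ^~ a) n).

Lemma obstruction_multilinear : multilinear2 obstruction.
Proof.
have linP : linear P by move=> k a b; apply/funext => i; rewrite /P linp.
split; last by move=> k a b; rewrite /= -!/(P _) linP (pext1_tlinear linal).1.
split=> [b k a a'|a k b b'] /=.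
  by rewrite -!/(P _) linP (pext2_tlinearl bilnu _).1.
by rewrite -!/(P _) linP (pext2_tlinearr bilnu _).1.
Qed.

(** The degree n coefficients of the Hom-pre-Lie identity and of the
    multiplicativity of the twist at P a, P b, P c.  Inside a product, N (P a)
    (P b) may be replaced by P (a · b) at the cost of one term, its error times
    a constant term.  After these replacements the expressions in degree n
    without an explicit product are themselves values of the obstruction, so
    that precisely the terms of the coboundary formula remain. *)
Lemma obstruction_cocycle :
  (forall a b c, (d2 obstruction).1 a b c = 0) /\
  (forall a b, (d2 obstruction).2 a b = 0).
Proof.
have NPn a b : N (P a) (P b) n = obstruction.1 a b by [].
have APn a : A (P a) n = obstruction.2 a by [].
have NP0 a b : N (P a) (P b) 0 = a · b by rewrite -P_mul // /P p0.
have AP0 a : A (P a) 0 = halpha a by rewrite P_alpha // /P p0.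
have eqN a b i : (i < n)%N -> N (P a) (P b) i = P (a · b) i.
  by move=> ltin; rewrite P_mul.
have eqA a i : (i < n)%N -> A (P a) i = P (halpha a) i by exact: P_alpha.
have Pn a : P a n = 0 by exact: pn.
have P0 a : P a 0 = a by exact: p0.
have congrN x x' y y' :
    (forall i, (i < n)%N -> x i = x' i) -> (forall i, (i < n)%N -> y i = y' i) ->
    N x y n = N x' y' n + (x n - x' n) · (y 0) + (x' 0) · (y n - y' n).
  by move=> eqx eqy; rewrite /N (pext2_congr bilnu eqx eqy) !nu0.
split=> [a b c|a b].
  have := congr1 (@^~ n) (hplN (P a) (P b) (P c)); rewrite !fctE.
  rewrite !(congrN _ _ _ _ (eqN _ _) (eqA _)).
  rewrite !(congrN _ _ _ _ (eqA _) (eqN _ _)).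
  rewrite !Pn !subr0 !P0 !NPn !APn !AP0 !NP0.
  case: obstruction => phi ps /=; move/eqP; rewrite -subr_eq0 => /eqP eq0.
  (* The cocycle expression is the opposite of the difference of both sides. *)
  rewrite -oppr0 -eq0 /d_nunu /d_alnu !opprD !opprK !addrA.
  by rewrite [LHS](ACl (7*4*11*6*10*1*8*3*12*5*9*2)).
have := congr1 (@^~ n) (alphaMN (P a) (P b)).
rewrite (congrN _ _ _ _ (eqA a) (eqA b)).
rewrite [A (N _ _)]/A (pext1_congr linal (eqN a b)) -/A.
rewrite !Pn !subr0 !P0 !NPn !APn al0 AP0.
case: obstruction => phi ps /=; move/eqP; rewrite -subr_eq0 => /eqP eq0.
rewrite -oppr0 -eq0 /d_nual /d_alal !opprD !opprK !addrA.
by rewrite [LHS](ACl (2*4*3*5*1)).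
Qed.

End Obstruction.

(** * Equivariant trivialization, degree by degree *)

Section Equivariance.

Variables (K : fieldType) (gT : finGroupType) (A : homPreLieType K).
Variable psi : hpl_action gT A.

Lemma res_act_linear g (H L : {group gT}) (sHL : (H :^ g)%g \subset L) :
  linear (res_act (psi := psi) sHL).
Proof.
move=> k a b; apply: val_inj.
by rewrite -[LHS]/(psi g (val (k *: a + b))) !linearP hact_linear.
Qed.

HB.instance Definition _ g (H L : {group gT}) (sHL : (H :^ g)%g \subset L) :=
  GRing.isLinear.Build K (fixed psi L) (fixed psi H) *:%R
    (res_act (psi := psi) sHL) (@res_act_linear g H L sHL).

Variable D : equivariant_deformation psi.

Notation nuD H := (@def_mul _ _ _ _ D H).
Notation alD H := (@def_alpha _ _ _ _ D H).

Lemma def_mul_res i g (H L : {group gT}) (sHL : (H :^ g)%g \subset L) a b :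
  nuD H i (res_act sHL a) (res_act sHL b) = res_act sHL (nuD L i a b).
Proof.
have := def_mul_act D sHL a b i.
by rewrite /= !pext2_pconst //; apply: def_mul_bilinear.
Qed.

Lemma def_alpha_res i g (H L : {group gT}) (sHL : (H :^ g)%g \subset L) a :
  alD H i (res_act sHL a) = res_act sHL (alD L i a).
Proof.
have := def_alpha_act D sHL a i.
by rewrite /= !pext1_pconst //; apply: def_alpha_linear.
Qed.

(** The degree n part of the requirements on a trivializing series.  Asking for
    the two equations on constants is enough by [tlinear_ext]; the invariance
    required by [in_S1] is what makes the next obstruction equivariant. *)
Definition trivializes (n : nat) (p : nat -> family1 psi) : Prop :=
  [/\ in_S1 (p n), n = 0 -> forall H a, p n H a = a,
      forall (H : {group gT}) (a b : fixed psi H),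
        p n H (a · b) =
        pext2 (nuD H) (fun i => p i H a) (fun i => p i H b) n &
      forall (H : {group gT}) (a : fixed psi H),
        pext1 (alD H) (fun i => p i H a) n = p n H (halpha a)].

Lemma trivializes_local n p p' :
  (forall k, (k <= n)%N -> p k = p' k) -> trivializes n p -> trivializes n p'.
Proof.
move=> eqp [S1p p0 mulp alp]; rewrite /trivializes -eqp //; split=> // H a.
  move=> b; rewrite mulp; apply: eq_bigr => i _; apply: eq_bigr => j _.
  by rewrite !eqp // ?(leq_trans (leq_ord j)) ?(leq_trans (leq_subr j _))
             ?leq_subr.
by rewrite -alp; apply: eq_bigr => i _; rewrite eqp ?leq_subr.
Qed.

Lemma trivializes0 p :
  trivializes 0 (fun k => if k == 0 then fun H => id else p k).
Proof.
split=> // [H a b|H a] /=; first by rewrite pext2_coef0 def_mul0.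
by rewrite pext1_coef0 def_alpha0.
Qed.

Hypothesis H20 : H2_vanishes psi.

(** The obstruction in degree n is delta f for an invariant f; taking - f as the
    new coefficient adds - delta f to the error in degree n. *)
Lemma trivializes_step n p :
  (0 < n)%N -> (forall k, (k < n)%N -> trivializes k p) ->
  exists f, trivializes n (fun k => if k == n then f else p k).
Proof.
move=> n_gt0 triv_p.
(* Degrees above n are cleared too, so that every coefficient of q is linear and
   invariant. *)
pose q k : family1 psi :=
  if (k < n)%N then p k else fun H => fun=> 0.
have triv_q k : (k < n)%N -> trivializes k q.
  move=> ltkn; apply: trivializes_local (triv_p k ltkn) => j lejk.
  by rewrite /q (leq_ltn_trans lejk).
have S1q k : in_S1 (q k).
  have [/triv_q[]//|lenk] := ltnP k n.
  rewrite /q ltnNge lenk; split=> [H c a b|g H L sHL a] /=.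
    by rewrite scaler0 addr0.
  by rewrite linear0.
have q0 H a : q 0 H a = a by have [_ -> //] := triv_q 0 n_gt0.
have qn H a : q n H a = 0 by rewrite /q ltnn.
pose c H := obstruction (nuD H) (alD H) (fun i => q i H) n.
have lin_q H i : linear (q i H) by exact: (S1q i).1.
have cob_c : coboundary2 c.
  apply: H20; split; last first.
    move=> H; apply: obstruction_cocycle => //.
    - exact: def_mul_bilinear.
    - exact: def_alpha_linear.
    - exact: def_mul0.
    - exact: def_alpha0.
    - apply: pext_hom_pre_lie; try exact: def_mul_bilinear.
        exact: def_alpha_linear.
      move=> x y z; apply/funext => i; exact: (def_hom_pre_lie D).
    - apply: pext_alphaM; try exact: def_mul_bilinear.
        exact: def_alpha_linear.
      move=> x y; apply/funext => i; exact: (def_alphaM D).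
    - by move=> i a b /triv_q[_ _ ->].
    - by move=> i a /triv_q[_ _ _ ->].
  split=> [H|g H L sHL].
    apply: obstruction_multilinear => //; first exact: def_mul_bilinear.
    exact: def_alpha_linear.
  have q_res i a : q i H (res_act sHL a) = res_act sHL (q i L a).
    exact: (S1q i).2.
  split=> [a b|a] /=; rewrite raddf_sum; apply: eq_bigr => i _.
    rewrite raddf_sum; apply: eq_bigr => j _.
    by rewrite !q_res def_mul_res.
  by rewrite q_res def_alpha_res.
have [f [lin_f f_res] cE] := cob_c.
exists (fun H a => - f H a).
have eq_lt k : (k < n)%N -> (if k == n then fun H a => - f H a else p k) = q k.
  by move=> ltkn; rewrite ltn_eqF // /q ltkn.
have eqn H a : (if n == n then fun H a => - f H a else p n) H a = - f H a.
  by rewrite eqxx.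
split.
- rewrite eqxx; split=> [H k a b|g H L sHL a].
    by rewrite lin_f opprD scalerN.
  by rewrite f_res linearN.
- by move=> n0; rewrite n0 in n_gt0.
- move=> H a b.
  rewrite (@pext2_congr _ _ _ _ _ _ n _ (q ^~ H ^~ a) _ (q ^~ H ^~ b)).
  + rewrite !eqn !eq_lt // !qn !q0 !subr0 !def_mul0.
    rewrite -[pext2 _ _ _ _]/((c H).1 a b) (cE H).1 /=.
    rewrite linearNr linearNl /= [RHS](ACl (3 * (1 * 5) * (2 * 4))) /=.
    by rewrite !subrr !addr0.
  + exact: def_mul_bilinear.
  + by move=> i ltin; rewrite eq_lt.
  + by move=> i ltin; rewrite eq_lt.
- move=> H a.
  rewrite (@pext1_congr _ _ _ _ n _ (q ^~ H ^~ a)).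
  + rewrite !eqn qn subr0 def_alpha0.
    rewrite -[pext1 _ _ _]/((c H).2 a) (cE H).2 /=.
    by rewrite linearN /= addrAC subrr add0r.
  + exact: def_alpha_linear.
  + by move=> i ltin; rewrite eq_lt.
Qed.

Lemma trivializing_series : exists p, forall n, trivializes n p.
Proof.
apply: (dependent_choice_prefix (fun H => id)); first exact: trivializes_local.
move=> [|n] p triv_p; first by exists (fun H => id); apply: trivializes0.
exact: trivializes_step.
Qed.

(** Both sides of each intertwining equation are K[[t]]-linear in every
    argument, so it suffices to compare them on constants, where they are the
    hypotheses. *)
Lemma trivializes_equivalent p :
  (forall n, trivializes n p) -> equivalent D (trivial_deformation psi).
Proof.
move=> triv_p H; exists (p ^~ H).
have linp i : linear (p i H) by have [[linp _] _ _ _] := triv_p i; exact: linp.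
have p0 a : p 0 H a = a by have [_ -> //] := triv_p 0.
have bilD i := @def_mul_bilinear _ _ _ _ D H i.
have bilT i := @triv_mul_bilinear _ _ _ psi H i.
have tp := pext1_tlinear linp.
have tN x := pext2_tlinearr bilD x.
have tN' y := pext2_tlinearl bilD y.
have tA := pext1_tlinear (@def_alpha_linear _ _ _ _ D H).
have PE a : pext1 (p ^~ H) (pconst a) = p ^~ H ^~ a.
  by apply/funext => n; rewrite pext1_pconst.
split=> //; first exact: pext1_bijective.
- move=> x y n; congr (_ n).
  apply: (tlinear_ext (tlinear_comp tp (pext2_tlinearl bilT y))
                      (tlinear_comp (tN' _) tp)) => a /=.
  apply: (tlinear_ext (tlinear_comp tp (pext2_tlinearr bilT (pconst a)))
                      (tlinear_comp (tN _) tp)) => b /=.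
  have -> : pext2 (triv_mul (psi := psi) (H := H)) (pconst a) (pconst b) =
            pconst (a · b) by apply/funext; apply: pext2_triv.
  by rewrite !PE; apply/funext => m; have [_ _ -> _] := triv_p m.
- move=> x n; congr (_ n).
  apply: (tlinear_ext (tlinear_comp tA tp)
    (tlinear_comp tp (pext1_tlinear (@triv_alpha_linear _ _ _ psi H)))) => a /=.
  have -> : pext1 (triv_alpha (psi := psi) (H := H)) (pconst a) =
            pconst (halpha a) by apply/funext; apply: pext1_triv.
  by rewrite !PE; apply/funext => m; have [_ _ _ ->] := triv_p m.
Qed.

End Equivariance.

Theorem corollary5p11 (K : fieldType) (gT : finGroupType)
    (A : homPreLieType K) (psi : hpl_action gT A)
    (charK0 : [pchar K]%R =i pred0) (regA : regular A)
    (H20 : H2_vanishes psi) :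
  equivariantly_rigid psi.
Proof.
move=> D; have [p triv_p] := trivializing_series D H20.
exact: trivializes_equivalent triv_p.
Qed.
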